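(* Let $f \in \mathscr{L}^1_{\flat}(\mathbb{R})$ and let $F$ be the convolution operator induced by $f$. Then $\mathscr{M}_F = \mathscr{T}(\mathbb{R})$. In other words, a mean $m$ on $L^{\infty}(\mathbb{R})$ satisfies $m(g*\phi) = m(\phi)$ for all $g \in \mathscr{L}^1_{\flat}(\mathbb{R})$ and all $\phi \in L^{\infty}(\mathbb{R})$ if and only if $m(f*\phi) = m(\phi)$ for all $\phi \in L^{\infty}(\mathbb{R})$.
   Context: All functions are real-valued. $L^{\infty}(\mathbb{R})$ is the space of essentially bounded functions on $\mathbb{R}$. For $f \in L^1(\mathbb{R})$, $\hat{f}(\xi) = \int_{-\infty}^{\infty} f(x)e^{-i\xi x}dx$. $\mathscr{L}^1_{\flat}(\mathbb{R})$ is the set of $f \in L^1(\mathbb{R})$ with $f \ge 0$ and $\hat{f}(0) = 1$. The convolution operator induced by $f$ is $F : L^{\infty}(\mathbb{R}) \to L^{\infty}(\mathbb{R})$, $(F\phi)(x) = (f*\phi)(x) = \int_{-\infty}^{\infty}\phi(x-t)f(t)dt$, and $(F^*\varphi)(\phi) = \varphi(F\phi)$ for $\varphi\in L^\infty(\mathbb{R})^*$. A mean on $L^{\infty}(\mathbb{R})$ is a $\varphi \in L^{\infty}(\mathbb{R})^*$ with $\varphi \ge 0$ and $\|\varphi\| = 1$. $\mathscr{M}_F$ is the set of all means $\varphi$ with $F^*\varphi = \varphi$ (for the fixed $F$). $\mathscr{T}(\mathbb{R})$ is the set of topologically invariant means, i.e. means $\varphi$ such that $G^*\varphi = \varphi$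 for the convolution operator $G$ induced by every $g \in \mathscr{L}^1_{\flat}(\mathbb{R})$. *)

(* Defs.v *)
From HB Require Import structures.
From mathcomp Require Import all_boot all_order all_algebra.
From mathcomp Require Import complex.
From mathcomp Require Import all_classical all_reals all_analysis.
From mathcomp Require Import ring lra measurable_realfun ess_sup_inf hoelder.

Set Implicit Arguments.
Unset Strict Implicit.
Unset Printing Implicit Defensive.

Import Order.TTheory GRing.Theory Num.Theory.
Import numFieldNormedType.Exports.

Local Open Scope classical_set_scope.
Local Open Scope ring_scope.

(* LspaceType (classes modulo mu-a.e. equality) carries no structure in the
   library; it is made into a normed space with the norm 'N[mu]_p. *)
Section Lspace_normed.
Context d (T : measurableType d) (R : realType).
Variables (mu : {measure set T -> \bar R}) (p : \bar R) (p1 : (1 <= p)%E).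
Local Notation Lsp := (LspaceType mu p1).

Lemma ae_eq_Lnorm (f g : T -> R) : measurable_fun setT f ->
  measurable_fun setT g -> f = g %[ae mu] ->
  'N[mu]_p[EFin \o f]%E = 'N[mu]_p[EFin \o g]%E.
Proof.
move=> mf mg fg; rewrite unlock /Lnorm; case: p p1 => [r r1|r1|//].
- congr (_ `^ _)%E; under eq_integral do rewrite /= -poweR_EFin.
  under [in RHS]eq_integral do rewrite /= -poweR_EFin.
  apply: ae_eq_integral => //.
  + apply/measurable_EFinP.
    apply: (@measurableT_comp _ _ _ _ _ _ (@powR R ^~ r)) => //.
    exact: measurableT_comp.
  + apply/measurable_EFinP.
    apply: (@measurableT_comp _ _ _ _ _ _ (@powR R ^~ r)) => //.
    exact: measurableT_comp.
  + by apply: filterS fg => x /= h _; rewrite h.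
- case: ifP => // _; apply: eq_ess_sup.
  by apply: filterS fg => x /= h; rewrite h.
Qed.

Definition Lspace_fun (f : Lsp) : T -> R := LebesgueSpace.sort f.

Lemma Lspace_fun_in (f : Lsp) : Lspace_fun f \in Lfun mu p.
Proof.
rewrite inE; apply/andP; split; rewrite inE.
  exact: (@measurable_funPT _ _ _ _ (repr (LebesgueSpace.sort f))).
exact: Lebesgue_finite.
Qed.

Definition Lspace_repr (f : Lsp) : LfunType mu p1 := Lfun_Sub p1 (Lspace_fun_in f).

Definition Lfun_mfun (g : LfunType mu p1) : {mfun T >-> measurableTypeR R} :=
  HB.pack_for {mfun T >-> measurableTypeR R} (g : T -> measurableTypeR R)
    (@isMeasurableFun.Build _ _ T (measurableTypeR R) g (@measurable_funPT _ _ _ _ g)).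

Definition Lfun_pi (g : LfunType mu p1) : {mfun_ mu, T >-> measurableTypeR R} :=
  (\pi_({mfun_ mu, T >-> measurableTypeR R}) (Lfun_mfun g))%qT.

Lemma Lfun_piE (g : LfunType mu p1) : repr (Lfun_pi g) = g %[ae mu].
Proof.
apply/asboolP; change (ae_eq_op mu (repr (Lfun_pi g)) (Lfun_mfun g)).
have /eqP := reprK (Lfun_pi g).
by rewrite /Lfun_pi eqmodE.
Qed.

Lemma pi_finite_norm (g : LfunType mu p1) : finite_norm mu p (Lfun_pi g).
Proof.
rewrite /finite_norm (@ae_eq_Lnorm _ g); first exact: Lfunction_finite.
- exact: (@measurable_funPT _ _ _ _ (repr (Lfun_pi g))).
- exact: measurable_funPT.
- exact: Lfun_piE.
Qed.

Definition Lspace_class (g : LfunType mu p1) : Lsp :=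
  LebesgueSpace.Pack (LebesgueSpace.Class
    (@isFinLebesgue.Axioms_ _ _ _ _ _ p1 _ (pi_finite_norm g))).

Lemma Lspace_classE (g : LfunType mu p1) :
  Lspace_fun (Lspace_class g) = g %[ae mu].
Proof. exact: Lfun_piE. Qed.

Lemma Lspace_eq (f g : Lsp) :
  Lspace_fun f = Lspace_fun g %[ae mu] -> f = g.
Proof.
case: f g => [f [[Nf]]] [g [[Ng]]]; rewrite /Lspace_fun/= => fg.
have {}fg : f = g.
  rewrite -(reprK f) -(reprK g); apply/eqquotP.
  by apply/asboolP.
by subst g; rewrite (bool_irrelevance Nf Ng).
Qed.

HB.instance Definition _ := gen_eqMixin Lsp.
HB.instance Definition _ := gen_choiceMixin Lsp.

Definition Lspace0 : Lsp := Lspace_class 0.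
Definition Lspace_opp (f : Lsp) : Lsp := Lspace_class (- Lspace_repr f).
Definition Lspace_add (f g : Lsp) : Lsp :=
  Lspace_class (Lspace_repr f + Lspace_repr g).
Definition Lspace_scale (a : R) (f : Lsp) : Lsp :=
  Lspace_class (a *: Lspace_repr f).

Lemma Lspace_addE (f g : Lsp) :
  Lspace_fun (Lspace_add f g) = Lspace_fun f \+ Lspace_fun g %[ae mu].
Proof. exact: Lspace_classE. Qed.

Lemma Lspace_oppE (f : Lsp) :
  Lspace_fun (Lspace_opp f) = \- Lspace_fun f %[ae mu].
Proof. exact: Lspace_classE. Qed.

Lemma Lspace_scaleE a (f : Lsp) :
  Lspace_fun (Lspace_scale a f) = a \*: Lspace_fun f %[ae mu].
Proof. exact: Lspace_classE. Qed.

Lemma Lspace0E : Lspace_fun Lspace0 = cst 0 %[ae mu].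
Proof. exact: Lspace_classE. Qed.

Lemma Lspace_addA : associative Lspace_add.
Proof.
move=> f g h; apply: Lspace_eq.
have H1 := Lspace_addE f (Lspace_add g h); have H2 := Lspace_addE g h.
have H3 := Lspace_addE (Lspace_add f g) h; have H4 := Lspace_addE f g.
near=> x => _; rewrite (near H1 x)//= (near H2 x)// (near H3 x)//= (near H4 x)//=.
by rewrite addrA.
Unshelve. all: by end_near. Qed.

Lemma Lspace_addC : commutative Lspace_add.
Proof.
move=> f g; apply: Lspace_eq.
have H1 := Lspace_addE f g; have H2 := Lspace_addE g f.
by near=> x => _; rewrite (near H1 x)//= (near H2 x)//= addrC.
Unshelve. all: by end_near. Qed.

Lemma Lspace_add0 : left_id Lspace0 Lspace_add.
Proof.
move=> f; apply: Lspace_eq.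
have H1 := Lspace_addE Lspace0 f; have H2 := Lspace0E.
by near=> x => _; rewrite (near H1 x)//= (near H2 x)//= add0r.
Unshelve. all: by end_near. Qed.

Lemma Lspace_addN : left_inverse Lspace0 Lspace_opp Lspace_add.
Proof.
move=> f; apply: Lspace_eq.
have H1 := Lspace_addE (Lspace_opp f) f; have H2 := Lspace0E.
have H3 := Lspace_oppE f.
by near=> x => _; rewrite (near H1 x)//= (near H2 x)//= (near H3 x)//= addNr.
Unshelve. all: by end_near. Qed.

HB.instance Definition _ := GRing.isZmodule.Build Lsp
  Lspace_addA Lspace_addC Lspace_add0 Lspace_addN.

Lemma Lspace_scaleA a b (f : Lsp) :
  Lspace_scale a (Lspace_scale b f) = Lspace_scale (a * b) f.
Proof.
apply: Lspace_eq.
have H1 := Lspace_scaleE a (Lspace_scale b f); have H2 := Lspace_scaleE b f.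
have H3 := Lspace_scaleE (a * b) f.
near=> x => _; rewrite (near H1 x)//= (near H2 x)//= (near H3 x)//=.
by rewrite scalerA.
Unshelve. all: by end_near. Qed.

Lemma Lspace_scale1 : left_id 1 Lspace_scale.
Proof.
move=> f; apply: Lspace_eq; have H1 := Lspace_scaleE 1 f.
by near=> x => _; rewrite (near H1 x)//= scale1r.
Unshelve. all: by end_near. Qed.

Lemma Lspace_scaleDr : right_distributive Lspace_scale +%R.
Proof.
move=> a f g; apply: Lspace_eq.
have H1 := Lspace_scaleE a (Lspace_add f g); have H2 := Lspace_addE f g.
have H3 := Lspace_addE (Lspace_scale a f) (Lspace_scale a g).
have H4 := Lspace_scaleE a f; have H5 := Lspace_scaleE a g.
near=> x => _; rewrite (near H1 x)//= (near H2 x)//= (near H3 x)//=.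
by rewrite (near H4 x)//= (near H5 x)//= scalerDr.
Unshelve. all: by end_near. Qed.

Lemma Lspace_scaleDl (f : Lsp) : {morph Lspace_scale^~ f : a b / a + b}.
Proof.
move=> a b; apply: Lspace_eq.
have H1 := Lspace_scaleE (a + b) f.
have H2 := Lspace_addE (Lspace_scale a f) (Lspace_scale b f).
have H3 := Lspace_scaleE a f; have H4 := Lspace_scaleE b f.
near=> x => _; rewrite (near H1 x)//= (near H2 x)//=.
by rewrite (near H3 x)//= (near H4 x)//= scalerDl.
Unshelve. all: by end_near. Qed.

HB.instance Definition _ := GRing.Zmodule_isLmodule.Build R Lsp
  Lspace_scaleA Lspace_scale1 Lspace_scaleDr Lspace_scaleDl.

Definition Lspace_norm (f : Lsp) : R :=
  fine 'N[mu]_p[EFin \o Lspace_fun f]%E.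

Lemma Lspace_class_norm (g : LfunType mu p1) :
  Lspace_norm (Lspace_class g) = fine 'N[mu]_p[EFin \o g]%E.
Proof.
congr fine; apply: ae_eq_Lnorm; last exact: Lspace_classE.
- exact: (@measurable_funPT _ _ _ _ (Lspace_repr _)).
- exact: measurable_funPT.
Qed.

Lemma Lspace_ler_normD (f g : Lsp) :
  Lspace_norm (f + g) <= Lspace_norm f + Lspace_norm g.
Proof.
rewrite Lspace_class_norm.
exact: (ler_LnormD (Lspace_repr f) (Lspace_repr g)).
Qed.

Lemma Lspace_normZ (a : R) (f : Lsp) :
  Lspace_norm (a *: f) = `|a| * Lspace_norm f.
Proof.
rewrite Lspace_class_norm; apply: EFin_inj.
rewrite EFinM (finite_norm_fine (a *: Lspace_repr f)).
rewrite -[(Lspace_norm f)%:E]/((fine 'N[mu]_p[EFin \o Lspace_repr f])%:E).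
by rewrite (finite_norm_fine (Lspace_repr f)); exact: (LnormZ (Lspace_repr f)).
Qed.

Lemma Lspace_norm_eq0 (f : Lsp) : Lspace_norm f = 0 -> f = 0.
Proof.
move=> /(@fine_Lnormr_eq0 _ _ _ mu p p1 (Lspace_repr f)) f0; apply: Lspace_eq.
have H := Lspace0E.
by near=> x => _; rewrite (near H x)//; apply: (near f0 x).
Unshelve. all: by end_near. Qed.

HB.instance Definition _ := Lmodule_isNormed.Build R Lsp
  Lspace_ler_normD Lspace_normZ Lspace_norm_eq0.

End Lspace_normed.

Section convolution_operator.
Context {R : realType}.
Local Notation mu := (@lebesgue_measure R).

Lemma lebesgue_measure_reflect (x : R) (A : set R) : measurable A ->
  pushforward mu (fun t => x - t : measurableTypeR R) A = mu A.
Proof.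
move=> mA; apply/esym/lebesgue_measure_unique => //=.
  exact: measurable_funB.
move=> mg _ [[a b]] _ <-; rewrite /pushforward.
rewrite (_ : _ @^-1` _ = `[x - b, x - a[%classic); last first.
  by apply/seteqP; split => t /=; rewrite !in_itv/= => /andP[? ?]; apply/andP;
    split; lra.
rewrite !lebesgue_measure_itv/= !lte_fin ltrD2l ltrN2; case: ifP => // _.
by rewrite -!EFinB; congr EFin; lra.
Qed.

Lemma ae_reflect (x : R) (P : set R) :
  (\forall t \ae mu, P t) -> \forall t \ae mu, P (x - t).
Proof.
move=> [N [mN N0 PN]]; exists ((fun t => x - t) @^-1` N); split.
- by rewrite -[X in measurable X]setTI; exact: measurable_funB.
- by rewrite -[RHS]N0 -(lebesgue_measure_reflect x mN).
- by move=> t /= nP; apply: PN.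
Qed.

(* (f * phi)(x); for f integrable and phi essentially bounded the integrand is
   integrable for every x (conv_integrable), and the value does not depend on
   the representative of phi (ae_eq_conv) *)
Definition convolution (f phi : R -> R) (x : R) : R :=
  \int[mu]_t (phi (x - t) * f t).

Lemma measurable_conv_ker (f phi : R -> R) : measurable_fun setT f ->
  measurable_fun setT phi ->
  measurable_fun setT (fun z : R * R => phi (z.1 - z.2) * f z.2).
Proof.
move=> mf mphi; apply: measurable_funM.
  by apply: (measurableT_comp mphi); exact: measurable_funB.
exact: measurableT_comp.
Qed.

Lemma measurable_conv (f phi : R -> R) : measurable_fun setT f ->
  measurable_fun setT phi -> measurable_fun setT (convolution f phi).
Proof.
move=> mf mphi; apply: measurableT_comp => //.
pose K (z : R * R) := (phi (z.1 - z.2) * f z.2)%:E.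
have mK : measurable_fun setT K.
  by apply/measurable_EFinP; exact: measurable_conv_ker.
have mp : measurable_fun setT (fubini_F mu K^\+%E).
  apply: measurable_fun_fubini_tonelli_F => //.
  apply: measurable_funepos; exact: mK.
have mn : measurable_fun setT (fubini_F mu K^\-%E).
  apply: measurable_fun_fubini_tonelli_F => //.
  apply: measurable_funeneg; exact: mK.
have := emeasurable_funB mp mn; congr measurable_fun; apply/funext => x.
rewrite [RHS]integralE; congr (_ - _)%E; apply: eq_integral => t _.
  by rewrite unlock.
by rewrite unlock.
Qed.

Lemma conv_le_abse (f phi : R -> R) (x M : R) : 0 <= M ->
  measurable_fun setT f -> measurable_fun setT phi ->
  (\forall t \ae mu, `|phi t| <= M) ->
  (\int[mu]_t `|(phi (x - t) * f t)%:E| <= M%:E * \int[mu]_t `|(f t)%:E|)%E.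
Proof.
move=> M0 mf mphi phiM.
have mk : measurable_fun setT (fun t : R => phi (x - t) * f t).
  apply: measurable_funM => //; apply: (measurableT_comp mphi).
  exact: measurable_funB.
rewrite -ge0_integralZl//; last first.
  by apply: measurableT_comp => //; exact/measurable_EFinP.
apply: ae_ge0_le_integral => //.
- by apply: measurableT_comp => //; exact/measurable_EFinP.
- by move=> t _; rewrite mule_ge0.
- apply: measurable_funeM.
  by apply: measurableT_comp => //; exact/measurable_EFinP.
- move: (ae_reflect x phiM); apply: (@filterS _ _ (ae_filter_ringOfSetsType mu)) => t /= phit _.
  by rewrite -EFinM lee_fin normrM ler_wpM2r.
Qed.

Lemma conv_integrable (f phi : R -> R) (x M : R) : 0 <= M ->
  mu.-integrable setT (EFin \o f) -> measurable_fun setT phi ->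
  (\forall t \ae mu, `|phi t| <= M) ->
  mu.-integrable setT (EFin \o (fun t => phi (x - t) * f t)).
Proof.
move=> M0 /integrableP[/measurable_EFinP mf foo] mphi phiM.
apply/integrableP; split.
  apply/measurable_EFinP; apply: measurable_funM => //.
  by apply: (measurableT_comp mphi); exact: measurable_funB.
apply: le_lt_trans (conv_le_abse x M0 mf mphi phiM) _.
by rewrite lte_mul_pinfty// lee_fin.
Qed.

Lemma conv_bound (f phi : R -> R) (x M : R) : 0 <= M ->
  mu.-integrable setT (EFin \o f) -> measurable_fun setT phi ->
  (\forall t \ae mu, `|phi t| <= M) ->
  (`|(convolution f phi x)%:E| <= M%:E * \int[mu]_t `|(f t)%:E|)%E.
Proof.
move=> M0 intf mphi phiM; have ik := conv_integrable x M0 intf mphi phiM.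
rewrite /convolution /Rintegral fineK; last exact: integrable_fin_num.
apply: le_trans (le_abse_integral _ _ _) _ => //.
  by case/integrableP: ik.
by apply: conv_le_abse => //; case/integrableP: intf => /measurable_EFinP.
Qed.

Lemma Linfty_ae_bound (phi : LfunType mu (leey 1%E)) :
  exists2 M : R, 0 <= M & \forall t \ae mu, `|phi t| <= M.
Proof.
exists (fine 'N[mu]_+oo[EFin \o phi]%E); first exact/fine_ge0/Lnorm_ge0.
have NE : 'N[mu]_+oo[EFin \o phi]%E = ess_sup mu (abse \o (EFin \o phi)).
  rewrite unlock /Lnorm ifT//.
  have := @lebesgue_measure_itv R `]-oo, +oo[; rewrite set_itvNyy/= => ->.
  by rewrite addye ?ltry.
have : (ess_sup mu (abse \o (EFin \o phi)) <= 'N[mu]_+oo[EFin \o phi])%E.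
  by rewrite NE.
move/ess_supP; apply: (@filterS _ _ (ae_filter_ringOfSetsType mu)) => t /=.
by rewrite -lee_fin finite_norm_fine.
Qed.

Lemma L1_integrable (f : LfunType mu (lexx 1%E)) :
  mu.-integrable setT (EFin \o f).
Proof. by apply/Lfun1_integrable; exact: LfunP. Qed.

Lemma conv_Lfun (f : LfunType mu (lexx 1%E)) (phi : LfunType mu (leey 1%E)) :
  convolution f phi \in Lfun mu +oo%E.
Proof.
have mf : measurable_fun setT f by exact: measurable_funPT.
have mphi : measurable_fun setT phi by exact: measurable_funPT.
rewrite inE; apply/andP; split; rewrite inE; first exact: measurable_conv.
have [M M0 phiM] := Linfty_ae_bound phi.
rewrite /= /finite_norm unlock /Lnorm; case: ifP => // _.
apply: (@le_lt_trans _ _ (M%:E * \int[mu]_t `|(f t)%:E|)%E).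
  apply/ess_supP/nearW => x /=.
  by apply: conv_bound => //; exact: L1_integrable.
rewrite lte_mul_pinfty//.
by have /integrableP[] := L1_integrable f.
Qed.

Lemma conv_linear (f : LfunType mu (lexx 1%E)) (a : R)
    (phi psi : LfunType mu (leey 1%E)) (x : R) :
  convolution f (a \*: phi \+ psi) x = a * convolution f phi x + convolution f psi x.
Proof.
have [M M0 phiM] := Linfty_ae_bound phi.
have [N N0 psiN] := Linfty_ae_bound psi.
have i1 := conv_integrable x M0 (L1_integrable f) (@measurable_funPT _ _ _ _ phi) phiM.
have i2 := conv_integrable x N0 (L1_integrable f) (@measurable_funPT _ _ _ _ psi) psiN.
rewrite /convolution -RintegralZl// -RintegralD//; last first.
  exact: (@integrableZl _ _ _ mu setT measurableT a _ i1).
by apply: eq_Rintegral => t _ /=; rewrite mulrDl mulrA.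
Qed.

Lemma ae_eq_conv (f phi psi : R -> R) (x : R) : measurable_fun setT f ->
  measurable_fun setT phi -> measurable_fun setT psi ->
  phi = psi %[ae mu] -> convolution f phi x = convolution f psi x.
Proof.
move=> mf mphi mpsi pp; congr fine; apply: ae_eq_integral => //.
- apply/measurable_EFinP; apply: measurable_funM => //.
  by apply: (measurableT_comp mphi); exact: measurable_funB.
- apply/measurable_EFinP; apply: measurable_funM => //.
  by apply: (measurableT_comp mpsi); exact: measurable_funB.
- by move: (ae_reflect x pp); apply: (@filterS _ _ (ae_filter_ringOfSetsType mu)) => t /= h _; rewrite h.
Qed.

End convolution_operator.

Section invariant_means.
Variable R : realType.
Local Notation mu := (@lebesgue_measure R).

Definition L1 := LspaceType mu (lexx 1%E).
Definition Linfty := LspaceType mu (leey 1%E).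

HB.instance Definition _ := NormedModule.on Linfty.

(* \hat f(xi) = \int f(x) e^{- i xi x} dx, split into real and imaginary parts
   since f is real-valued *)
Definition fourier (f : L1) (xi : R) : R[i] :=
  ((\int[mu]_x (Lspace_fun f x * cos (xi * x)))
   +i* (- \int[mu]_x (Lspace_fun f x * sin (xi * x))))%C.

Definition L1flat : set L1 :=
  [set f | (\forall x \ae mu, 0 <= Lspace_fun f x) /\ fourier f 0 = 1].

Definition conv_op (f : L1) (phi : Linfty) : Linfty :=
  Lspace_class (Lfun_Sub (leey 1%E) (conv_Lfun (Lspace_repr f) (Lspace_repr phi))).

Lemma conv_op_linear (f : L1) : linear (conv_op f).
Proof.
move=> a phi psi; apply: Lspace_eq.
have H1 := Lspace_scaleE a phi; have H2 := Lspace_addE (a *: phi) psi.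
have H3 := Lspace_scaleE a (conv_op f phi).
have H4 := Lspace_addE (a *: conv_op f phi) (conv_op f psi).
have C (g : Linfty) : Lspace_fun (conv_op f g) =
  convolution (Lspace_fun f) (Lspace_fun g) %[ae mu] by exact: Lspace_classE.
have C1 := C (a *: phi + psi); have C2 := C phi; have C3 := C psi.
have E : Lspace_fun (a *: phi + psi) =
    a \*: Lspace_fun phi \+ Lspace_fun psi %[ae mu].
  by near=> x => _; rewrite (near H2 x)//= (near H1 x).
near=> x => _; rewrite (near C1 x)// (near H4 x)//= (near H3 x)//=.
rewrite (near C2 x)// (near C3 x)//.
rewrite -(conv_linear (Lspace_repr f) a (Lspace_repr phi) (Lspace_repr psi)).
apply: ae_eq_conv => //.
- exact: (@measurable_funPT _ _ _ _ (Lspace_repr f)).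
- exact: (@measurable_funPT _ _ _ _ (Lspace_repr (a *: phi + psi))).
- exact: (@measurable_funPT _ _ _ _ (a *: Lspace_repr phi + Lspace_repr psi)).
Unshelve. all: by end_near. Qed.

HB.instance Definition _ (f : L1) :=
  GRing.isLinear.Build R Linfty Linfty _ (conv_op f) (conv_op_linear f).

(* the operator norm of m; meaningful for continuous m, as sup is 0 on unbounded
   sets *)
Definition dual_norm (m : {scalar Linfty}) : R :=
  sup [set `|m phi| | phi in [set phi : Linfty | `|phi| <= 1]].

Definition is_mean (m : {scalar Linfty}) : Prop :=
  [/\ continuous (m : Linfty -> R),
      forall phi : Linfty, (\forall x \ae mu, 0 <= Lspace_fun phi x) -> 0 <= m phi
    & dual_norm m = 1].

Definition adjoint (F : {linear Linfty -> Linfty}) (m : {scalar Linfty}) :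
  {scalar Linfty} := m \o F.

Definition invariant_means (F : {linear Linfty -> Linfty}) : set {scalar Linfty} :=
  [set m | is_mean m /\ adjoint F m =1 m].

Definition top_invariant_means : set {scalar Linfty} :=
  [set m | is_mean m /\ forall g, L1flat g -> adjoint (conv_op g) m =1 m].

End invariant_means.

Arguments top_invariant_means : clear implicits.

(* Main.v *)
Require Import Defs.
From mathcomp Require Import all_boot all_order all_algebra.
From mathcomp Require complex.
From mathcomp Require Import all_classical all_reals all_analysis.
From mathcomp Require Import ring lra measurable_realfun ess_sup_inf hoelder.

Import Order.TTheory GRing.Theory Num.Theory.
Import numFieldNormedType.Exports.

Set Implicit Arguments.
Unset Strict Implicit.
Unset Printing Implicit Defensive.

Local Open Scope classical_set_scope.
Local Open Scope ring_scope.

(* Let m be an f-invariant mean, F phi = f * phi, and let K be the set of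
   integrable g with m(g * phi) = (int g) m(phi) for all phi.
   (1) K contains b f for every bounded b. If int b f = 0, expanding
   int f(t) (phi(x - t) - F phi(x) - l b(t))^2 dt >= 0 and applying m gives
   2 l m((b f) * phi) <= m(phi^2) - m((F phi)^2) + l^2 c. For phi = F^n psi
   the left side does not depend on n while the right side telescopes, hence
   m((b f) * psi) = 0.
   (2) So K contains 1_E for some E of positive measure, and 1_E * 1_E; the
   latter is bounded below on an interval by the density theorem, and by (1)
   every bounded function supported in that interval is in K.
   (3) If k is in K, int k = 1 and g * k is in K, then g is in K, because
   m(g * phi) = m(k * g * phi). This extends (2) to all bounded intervals, and
   K is closed in L^1. *)

(** * Bounded measurable functions, reflections and translations of integrals *)

Section bounded_measurable.
Context {R : realType}.
Local Notation mu := (@lebesgue_measure R).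
Local Notation intg f := (mu.-integrable setT (EFin \o f)).

(** The bound holds everywhere, not just almost everywhere: test functions are handled as functions
    rather than classes, so that convolutions against integrable functions are defined at every
    point and identities can be checked pointwise. *)
Definition bdd_mfun (phi : R -> R) : Prop :=
  measurable_fun setT phi /\ exists M, forall x, `|phi x| <= M.

Lemma bdd_mfun_cst (c : R) : bdd_mfun (fun=> c).
Proof. by split; [exact: measurable_cst|exists `|c|]. Qed.

Lemma bdd_mfun_lin (a : R) (phi psi : R -> R) : bdd_mfun phi -> bdd_mfun psi ->
  bdd_mfun (fun x => a * phi x + psi x).
Proof.
move=> [mphi [M phiM]] [mpsi [N psiN]]; split.
  by apply: measurable_funD => //; exact: measurable_funM.
exists (`|a| * M + N) => x; rewrite (le_trans (ler_normD _ _))// lerD// normrM.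
exact: ler_wpM2l.
Qed.

Lemma bdd_mfunM (phi psi : R -> R) : bdd_mfun phi -> bdd_mfun psi ->
  bdd_mfun (fun x => phi x * psi x).
Proof.
move=> [mphi [M phiM]] [mpsi [N psiN]]; split; first exact: measurable_funM.
by exists (M * N) => x; rewrite normrM ler_pM.
Qed.

Lemma bdd_mfun_indic (A : set R) : measurable A -> bdd_mfun (\1_A).
Proof.
move=> mA; split; first exact: measurable_indic.
by exists 1 => x; rewrite indicE; case: (x \in A); rewrite ?normr1 ?normr0.
Qed.

Lemma bdd_mfun_reflect (phi : R -> R) (x : R) : bdd_mfun phi ->
  bdd_mfun (fun t => phi (x - t)).
Proof.
move=> [mphi [M phiM]]; split; last by exists M.
by apply: (measurableT_comp mphi); exact: measurable_funB.
Qed.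

Lemma intg_meas (f : R -> R) : intg f -> measurable_fun setT f.
Proof. by case/integrableP => /measurable_EFinP. Qed.

Lemma integrable_bddM (f b : R -> R) : intg f -> bdd_mfun b ->
  intg (fun t => b t * f t).
Proof.
move=> f1 [mb [M bM]].
apply: (@le_integrable _ _ _ mu setT measurableT _ (EFin \o (fun t => M * f t))).
- apply/measurable_EFinP; apply: measurable_funM => //; exact: intg_meas.
- move=> x _ /=; rewrite lee_fin !normrM ler_wpM2r//.
  by rewrite (le_trans (bM x))// ler_norm.
- exact: (@integrableZl _ _ _ mu setT measurableT M _ f1).
Qed.

Lemma integrable_lin (a : R) (f g : R -> R) : intg f -> intg g ->
  intg (fun t => a * f t + g t).
Proof.
move=> f1 g1; have af1 := @integrableZl _ _ _ mu setT measurableT a _ f1.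
exact: (@integrableD _ _ _ mu setT measurableT _ _ af1 g1).
Qed.

Lemma Rintegral_lin (a : R) (f g : R -> R) : intg f -> intg g ->
  \int[mu]_t (a * f t + g t) = a * \int[mu]_t f t + \int[mu]_t g t.
Proof.
move=> f1 g1; rewrite RintegralD// ?RintegralZl//.
exact: (@integrableZl _ _ _ mu setT measurableT a _ f1).
Qed.

Lemma ge0_integral_reflect (x : R) (u : R -> \bar R) : measurable_fun setT u ->
  (forall t, 0 <= u t)%E -> (\int[mu]_t u (x - t)%R = \int[mu]_t u t)%E.
Proof.
move=> mfu u0.
have mr : measurable_fun setT (fun t : measurableTypeR R => x - t : measurableTypeR R).
  exact: measurable_funB.
have := @ge0_integral_pushforward _ _ (measurableTypeR R) (measurableTypeR R) R
  _ mr mu setT u measurableT mfu.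
rewrite preimage_setT => <-; last by move=> ? _; exact: u0.
by apply: eq_measure_integral => A mA _; exact: lebesgue_measure_reflect.
Qed.

(** A translation is a composite of two reflections: reflecting the left side about [0] and the
    right side about [- s] produces the same integrand. *)
Lemma ge0_integral_translate (s : R) (u : R -> \bar R) : measurable_fun setT u ->
  (forall t, 0 <= u t)%E -> (\int[mu]_t u (t - s)%R = \int[mu]_t u t)%E.
Proof.
move=> mfu u0; have mu' : measurable_fun setT (fun t : R => u (t - s)).
  by apply: (measurableT_comp mfu); exact: measurable_funB.
rewrite -(ge0_integral_reflect 0 mu')// -(ge0_integral_reflect (- s) mfu)//.
by apply: eq_integral => t _; congr u; rewrite sub0r addrC.
Qed.

Lemma integrable_translate (s : R) (f : R -> R) : intg f ->
  intg (fun t => f (t - s)).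
Proof.
move=> f1; have mf := intg_meas f1; apply/integrableP; split.
  apply/measurable_EFinP; apply: (measurableT_comp mf); exact: measurable_funB.
rewrite (ge0_integral_translate s (u := fun t => `|(f t)%:E|%E))//.
  by case/integrableP: f1.
by apply: measurableT_comp => //; exact/measurable_EFinP.
Qed.

Lemma Rintegral_translate (s : R) (f : R -> R) : measurable_fun setT f ->
  \int[mu]_t f (t - s) = \int[mu]_t f t.
Proof.
move=> mf; congr fine; rewrite integralE [RHS]integralE; congr (_ - _)%E.
  rewrite -(ge0_integral_translate s (u := (EFin \o f)^\+%E))//.
    by apply: eq_integral => t _; rewrite !funeposE.
  by apply: measurable_funepos; exact/measurable_EFinP.
rewrite -(ge0_integral_translate s (u := (EFin \o f)^\-%E))//.
  by apply: eq_integral => t _; rewrite !funenegE.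
by apply: measurable_funeneg; exact/measurable_EFinP.
Qed.

(** * Algebra of convolution with bounded functions *)

Lemma conv_bdd_int (f phi : R -> R) (x : R) : intg f -> bdd_mfun phi ->
  intg (fun t => phi (x - t) * f t).
Proof. by move=> f1 bphi; apply: integrable_bddM => //; exact: bdd_mfun_reflect. Qed.

Lemma conv_norm_le (f phi : R -> R) (M x : R) : intg f -> measurable_fun setT phi ->
  (forall t, `|phi t| <= M) ->
  `|convolution f phi x| <= M * \int[mu]_t `|f t|.
Proof.
move=> f1 mphi phiM.
have M0 : 0 <= M by rewrite (le_trans _ (phiM 0)).
have bphi : bdd_mfun phi by split=> //; exists M.
apply: (le_trans (le_normr_Rintegral measurableT (conv_bdd_int x f1 bphi))).
have f1' : intg (fun t => `|f t|) by apply: integrable_norm.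
rewrite -RintegralZl//; apply: le_Rintegral => //.
- by apply: (integrable_norm (conv_bdd_int x f1 bphi)).
- exact: (@integrableZl _ _ _ mu setT measurableT M _ f1').
- by move=> t _; rewrite normrM ler_wpM2r.
Qed.

Lemma bdd_mfun_conv (f phi : R -> R) : intg f -> bdd_mfun phi ->
  bdd_mfun (convolution f phi).
Proof.
move=> f1 [mphi [M phiM]]; split.
  by apply: measurable_conv => //; exact: intg_meas.
by exists (M * \int[mu]_t `|f t|) => x; exact: conv_norm_le.
Qed.

Lemma convDl (a : R) (f g phi : R -> R) : intg f -> intg g -> bdd_mfun phi ->
  convolution (fun t => a * f t + g t) phi =
  (fun x => a * convolution f phi x + convolution g phi x).
Proof.
move=> f1 g1 bphi; apply/funext => x.
have i1 := conv_bdd_int x f1 bphi; have i2 := conv_bdd_int x g1 bphi.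
by rewrite /convolution -Rintegral_lin//; apply: eq_Rintegral => t _; ring.
Qed.

Lemma conv_cst (f : R -> R) (c : R) : intg f ->
  convolution f (fun=> c) = fun=> c * \int[mu]_t f t.
Proof. by move=> f1; apply/funext => x; rewrite /convolution RintegralZl. Qed.

(** By Tonelli, the bound [C * |f s|] on the inner integrals makes [G] integrable on the product.
    Integrability of every section then lets Fubini be stated with real-valued integrals.
    Commutativity and associativity of convolution both come from this. *)
Lemma Fubini_dominated (f : R -> R) (G : R * R -> R) (C : R) :
  intg f -> measurable_fun setT G ->
  (forall s, intg (fun t => G (s, t))) -> (forall t, intg (fun s => G (s, t))) ->
  (forall s, \int[mu]_t `|G (s, t)| <= C * `|f s|) ->
  intg (fun t => \int[mu]_s G (s, t)) /\
  \int[mu]_s \int[mu]_t G (s, t) = \int[mu]_t \int[mu]_s G (s, t).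
Proof.
move=> f1 mG G1 G2 GC.
have mG' : measurable_fun setT (EFin \o G) by exact/measurable_EFinP.
have iG : (mu \x mu)%E.-integrable setT (EFin \o G).
  apply/integrable12ltyP => //.
  have i1 : intg (fun s => C * `|f s|).
    apply: (@integrableZl _ _ _ mu setT measurableT _ (EFin \o (fun s => `|f s|))).
    exact: integrable_norm.
  apply: (@le_lt_trans _ _ (\int[mu]_s (C * `|f s|)%:E)%E).
    apply: ge0_le_integral => //.
    - by move=> s _; apply: integral_ge0.
    - have mG2 : measurable_fun setT (abse \o (EFin \o G)).
        exact: measurableT_comp.
      exact: (measurable_fun_fubini_tonelli_F (m2 := mu) _ mG2 (fun=> abse_ge0 _)).
    - by apply/measurable_EFinP; exact: intg_meas.
    - move=> s _; rewrite -[leLHS]fineK ?lee_fin; first exact: GC.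
      by apply: (integrable_fin_num measurableT); exact: integrable_norm (G1 s).
  by rewrite ltey_eq (integrable_fin_num measurableT i1).
have := Fubini iG => /= FG; split.
  have i21 := (integrable21ltyP mu mu mG').1 iG.
  have GE : EFin \o (fun t => \int[mu]_s G (s, t)) = fubini_G mu (EFin \o G).
    apply/funext => t; rewrite /= /fubini_G /Rintegral fineK//.
    exact: integrable_fin_num (G2 t).
  rewrite GE; have mFG := measurable_fubini_G iG.
  apply/integrableP; split => //; apply: le_lt_trans i21.
  apply: ge0_le_integral => //.
  - exact: measurableT_comp.
  - have mG2 : measurable_fun setT (abse \o (EFin \o G)).
      exact: measurableT_comp.
    exact: (measurable_fun_fubini_tonelli_G (m1 := mu) _ mG2 (fun=> abse_ge0 _)).
  - move=> t _; apply: le_abse_integral => //.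
    by case/integrableP: (G2 t).
rewrite /Rintegral; congr fine.
transitivity (\int[mu]_s \int[mu]_t (G (s, t))%:E)%E.
  by apply: eq_integral => s _; rewrite fineK//; exact: integrable_fin_num (G1 s).
rewrite FG.
by apply: eq_integral => t _; rewrite fineK//; exact: integrable_fin_num (G2 t).
Qed.

(** Both sides are iterated integrals of [phi (x - s - t) * h t * f s], taken in opposite orders. *)
Lemma conv_comm (f h phi : R -> R) : intg f -> intg h -> bdd_mfun phi ->
  convolution f (convolution h phi) = convolution h (convolution f phi).
Proof.
move=> f1 h1 bphi; apply/funext => x; have [mphi [M phiM]] := bphi.
have mf := intg_meas f1; have mh := intg_meas h1.
pose G (z : R * R) := phi (x - z.1 - z.2) * h z.2 * f z.1.
have bd y : intg (fun t => phi (y - t) * h t) by exact: conv_bdd_int.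
have bd' y : intg (fun t => phi (y - t) * f t) by exact: conv_bdd_int.
have swap s t : phi (x - s - t) = phi (x - t - s) by congr phi; ring.
have G1 s : intg (fun t => G (s, t)).
  exact: (@integrableZr _ _ _ mu setT measurableT (f s) _ (bd (x - s))).
have G2 t : intg (fun s => G (s, t)).
  apply: (@eq_integrable _ _ _ mu setT measurableT (fun s => (phi (x - t - s) * f s * h t)%:E)).
    by move=> s _; rewrite /G /= swap mulrAC.
  exact: (@integrableZr _ _ _ mu setT measurableT (h t) _ (bd' (x - t))).
have mG : measurable_fun setT G.
  apply: measurable_funM; last exact: measurableT_comp.
  apply: measurable_funM; last exact: measurableT_comp.
  by apply: (measurableT_comp mphi); do 2 apply: measurable_funB => //.
have GC s : \int[mu]_t `|G (s, t)| <= (M * \int[mu]_t `|h t|) * `|f s|.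
  have ih : intg (fun u => `|h u|) by exact: integrable_norm.
  rewrite mulrAC -RintegralZl//; apply: le_Rintegral => //.
  - exact: integrable_norm.
  - exact: (@integrableZl _ _ _ mu setT measurableT _ (EFin \o (fun u => `|h u|))).
  - by move=> t _; rewrite /G !normrM mulrAC ler_wpM2r// ler_wpM2r.
have [_] := Fubini_dominated f1 mG G1 G2 GC.
rewrite /G /convolution /=.
under eq_Rintegral do rewrite RintegralZr//.
move=> ->; apply: eq_Rintegral => t _; rewrite -RintegralZr//.
by apply: eq_Rintegral => s _; rewrite swap mulrAC.
Qed.

(** Fubini for [phi (x - t) * h (t - s) * f s], followed by the translation [t -> t - s] in the
    inner integral. Boundedness of [h] makes [convolution f h] an honest integral at every point.
    The integrability part, taken with [phi = 1], later shows that [convolution f h] is itself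
    integrable. *)
Lemma conv_fubini (f h phi : R -> R) (x : R) : intg f -> intg h ->
  bdd_mfun h -> bdd_mfun phi ->
  intg (fun t => phi (x - t) * convolution f h t) /\
  convolution (convolution f h) phi x = convolution f (convolution h phi) x.
Proof.
move=> f1 h1 bh bphi; have [mphi [M phiM]] := bphi; have [mh [N hN]] := bh.
have mf := intg_meas f1.
pose G (z : R * R) := phi (x - z.2) * h (z.2 - z.1) * f z.1.
have mG : measurable_fun setT G.
  apply: measurable_funM; last exact: measurableT_comp.
  apply: measurable_funM.
    by apply: (measurableT_comp mphi); exact: measurable_funB.
  by apply: (measurableT_comp mh); exact: measurable_funB.
have i1 s : intg (fun t => phi (x - t) * h (t - s)).
  by apply: (conv_bdd_int x (integrable_translate s h1)).
have G1 s : intg (fun t => G (s, t)).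
  exact: (@integrableZr _ _ _ mu setT measurableT (f s) _ (i1 s)).
have i2 t : intg (fun s => h (t - s) * f s) by exact: conv_bdd_int.
have G2 t : intg (fun s => G (s, t)).
  apply: (@eq_integrable _ _ _ mu setT measurableT
    (fun s => (phi (x - t) * (h (t - s) * f s))%:E)).
    by move=> s _; rewrite /G /= mulrA.
  exact: (@integrableZl _ _ _ mu setT measurableT (phi (x - t)) _ (i2 t)).
have GC s : \int[mu]_t `|G (s, t)| <= (M * \int[mu]_t `|h t|) * `|f s|.
  have ih : intg (fun u => `|h u|) by exact: integrable_norm.
  have ihs := integrable_translate s ih.
  rewrite -(@Rintegral_translate s (fun t => `|h t|)); last exact: measurableT_comp.
  rewrite mulrAC -RintegralZl//; apply: le_Rintegral => //.
  - exact: integrable_norm.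
  - exact: (@integrableZl _ _ _ mu setT measurableT _ (EFin \o (fun u => `|h (u - s)|))).
  - by move=> t _; rewrite /G !normrM mulrAC ler_wpM2r// ler_wpM2r.
have GE t : \int[mu]_s G (s, t) = phi (x - t) * convolution f h t.
  rewrite /convolution -RintegralZl//; apply: eq_Rintegral => s _.
  by rewrite /G /= mulrA.
have [] := Fubini_dominated f1 mG G1 G2 GC.
have -> : (fun t => \int[mu]_s G (s, t)) = (fun t => phi (x - t) * convolution f h t).
  exact/funext.
move=> G3 G4; split=> //; rewrite [LHS]/convolution -G4; apply: eq_Rintegral => s _.
rewrite /G/= RintegralZr//; congr (_ * _).
rewrite [RHS]/convolution -(@Rintegral_translate s (fun t => phi (x - s - t) * h t)).
  by apply: eq_Rintegral => t _; congr (phi _ * _); ring.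
exact: intg_meas (conv_bdd_int (x - s) h1 bphi).
Qed.

Lemma conv_assoc (f h phi : R -> R) : intg f -> intg h ->
  bdd_mfun h -> bdd_mfun phi ->
  convolution (convolution f h) phi = convolution f (convolution h phi).
Proof.
by move=> f1 h1 bh bphi; apply/funext => x; case: (conv_fubini x f1 h1 bh bphi).
Qed.

Lemma integrable_conv (f h : R -> R) : intg f -> intg h -> bdd_mfun h ->
  intg (convolution f h).
Proof.
move=> f1 h1 bh; have [ih _] := conv_fubini 0 f1 h1 bh (bdd_mfun_cst 1).
suff <- : (fun t => 1 * convolution f h t) = convolution f h by [].
by apply/funext => t; rewrite mul1r.
Qed.

(** Convolving with the constant [1] returns the integral, so this is associativity tested on
    [1]. *)
Lemma Rintegral_conv (f h : R -> R) : intg f -> intg h -> bdd_mfun h ->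
  \int[mu]_t convolution f h t = \int[mu]_t f t * \int[mu]_t h t.
Proof.
move=> f1 h1 bh.
have := conv_assoc f1 h1 bh (bdd_mfun_cst 1).
rewrite !conv_cst//; last exact: integrable_conv.
by move=> /(congr1 (fun u => u 0)); rewrite !mul1r mulrC.
Qed.

End bounded_measurable.

(** * Level sets, Lebesgue density and the self-convolution of an indicator *)

Section density.
Context {R : realType}.
Local Notation mu := (@lebesgue_measure R).
Local Notation intg f := (mu.-integrable setT (EFin \o f)).

(** A bounded substitute for [1 / f], equal to it wherever [c <= f]. *)
Lemma bdd_mfun_inv_max (f : R -> R) (c : R) : measurable_fun setT f -> 0 < c ->
  bdd_mfun (fun t => (Num.max (f t) c)^-1).
Proof.
move=> mf c0; have M0 y : 0 < Num.max y c by rewrite lt_max c0 orbT.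
split; last first.
  exists c^-1 => x; rewrite gtr0_norm ?invr_gt0//.
  by rewrite lef_pV2 ?posrE// le_max lexx orbT.
apply: (@measurableT_comp _ _ _ _ _ _ (fun y : R => (Num.max y c)^-1)) => //.
apply: continuous_measurable_fun => y; apply: cvgV; first by rewrite gt_eqF.
by apply: continuous_max; [exact: cvg_id|exact: cvg_cst].
Qed.

(** If every set where [f] is at least [1 / (n + 1)] were null, then [f <= 0] almost everywhere and
    the integral could not be positive. *)
Lemma pos_level_set (f : R -> R) : intg f -> 0 < \int[mu]_t f t ->
  exists c E, [/\ 0 < c, measurable E, (0 < mu E)%E & forall t, E t -> c <= f t].
Proof.
move=> f1 If; have mf := intg_meas f1.
pose E n := [set t | n.+1%:R^-1 <= f t].
have mE n : measurable (E n).
  have := measurable_fun_le measurableT (@measurable_cst _ _ _ _ _ (n.+1%:R^-1 : R)) mf.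
  by rewrite setTI.
apply: contrapT => H.
have E0 n : mu (E n) = 0.
  apply/eqP; rewrite -measure_le0 leNgt; apply/negP => En; case: H.
  by exists n.+1%:R^-1, (E n); split => //; exact: mE.
have : (\int[mu]_t f t <= 0).
  have mp : measurable_fun setT (fun t => Num.max (f t) 0).
    by apply: measurable_maxr => //; exact: measurable_cst.
  have N0 : (\int[mu]_t (Num.max (f t) 0)%:E = \int[mu]_t (cst 0 t))%E.
    apply: ae_eq_integral => //; first exact/measurable_EFinP.
    have : mu.-negligible (\bigcup_n E n).
      by apply: negligible_bigcup => n; apply: (negligibleP _ _).2; [exact: mE|exact: E0].
    apply: negligibleS => t /= ht; apply: contrapT => nE; apply: ht => _.
    congr EFin; apply/max_idPr; rewrite leNgt; apply/negP => ft0; apply: nE.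
    have [n nf] := ltr_add_invr ft0.
    by exists n => //; rewrite /E /= ltW// -[X in X < _]add0r.
  rewrite integral0 in N0.
  suff : (\int[mu]_t (f t)%:E <= 0)%E.
    by move=> H0; rewrite /Rintegral; apply: fine_le0.
  rewrite -N0; apply: le_integral => //.
  - apply: (le_integrable measurableT _ _ f1); first exact/measurable_EFinP.
    move=> t _ /=; rewrite lee_fin.
    by have [h|h] := leP (f t) 0; rewrite ?normr0.
  - by move=> t _; rewrite lee_fin le_max lexx.
by rewrite leNgt If.
Qed.

Lemma density_ball (E : set R) : measurable E -> (0 < mu E)%E ->
  exists p r, 0 < r /\ ((9 / 5 * r)%:E < mu (E `&` ball p r))%E.
Proof.
move=> mE E0.
have [N [mN N0 EN]] := lebesgue_density mE.
have [p Ep Np] : exists2 p, E p & ~ N p.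
  apply: contrapT => H; have : E `<=` N.
    by move=> p Ep; apply: contrapT => Np; apply: H; exists p.
  move=> EsN; have : (mu E <= mu N)%E by apply: le_measure => //; rewrite inE.
  by rewrite N0 leNgt E0.
have : ((mu (E `&` ball p r) * (mu (ball p r))^-1)%E @[r --> 0^'+] --> (\1_E p)%:E).
  by apply: contrapT => H; apply: Np; exact: EN.
rewrite indicE mem_set//= => /fine_cvgP [_ /= cv].
(* The density at [p] is 1, so small balls have relative density above [9 / 10]; since a ball of
   radius [r] has measure [2 r], this gives the [9 / 5 * r] of the statement. *)
have l9 : (9 / 10 : R) < 1 by lra.
have ev := cvgr_gt _ cv _ l9.
have [r [r0 rE]] : exists r : R, 0 < r /\
    9 / 10 < fine (mu (E `&` ball p r) * (mu (ball p r))^-1)%E.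
  have : \forall r \near 0^'+, 0 < r /\
    9 / 10 < fine (mu (E `&` ball p r) * (mu (ball p r))^-1)%E.
    near=> r; split; [by []|near: r; exact: ev].
  by move=> /filter_ex [r]; exists r.
exists p, r; split => //; move: rE.
rewrite lebesgue_measure_ball ?(ltW r0)//.
have mB := measurable_ball p r.
have fE : mu (E `&` ball p r) \is a fin_num.
  have : (mu (E `&` ball p r) <= mu (ball p r))%E.
    have mEB : measurable (E `&` ball p r) by exact: measurableI.
    by apply: le_measure => //; rewrite inE.
  rewrite lebesgue_measure_ball ?(ltW r0)// ge0_fin_numE// => /le_lt_trans; apply.
  by rewrite ltry.
have r2 : 0 < r *+ 2 by rewrite mulrn_wgt0.
rewrite -(fineK fE) inver (gt_eqF r2) -EFinM lte_fin /= ltr_pdivlMr// mulr2n.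
by apply: le_lt_trans; lra.
Unshelve. all: by end_near. Qed.

(** Pointwise inclusion-exclusion. Here [e1] and [e2] stand for membership of [x - t] and [t] in
    [E]. As [x] is within [r / 2] of [2 p], the ball around [p] and its reflection [x - ball] both
    lie in the interval of radius [3 / 2 * r] around [p], so two memberships minus that of the
    interval are at most the product. *)
Lemma indic_overlap (p r x t : R) (e1 e2 : bool) : 0 < r ->
  `|x - 2 * p| <= r / 2 ->
  -1 * (p - 3 / 2 * r <= t <= p + 3 / 2 * r)%R%:R
  + (1 * (e1 && (`|p - (x - t)| < r)%R)%:R + (e2 && (`|p - t| < r)%R)%:R)
  <= e1%:R * e2%:R :> R.
Proof.
move=> r0; rewrite ler_norml => /andP[x1 x2].
have [/andP[-> B2]|n2] := boolP (e2 && _).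
  have -> : p - 3 / 2 * r <= t <= p + 3 / 2 * r.
    by move: B2; rewrite ltr_norml => /andP[? ?]; apply/andP; split; lra.
  by case: e1 => /=; [case: (_ < _)|]; rewrite /=; lra.
have [/andP[-> B1]|n1] := boolP (e1 && _).
  have -> : p - 3 / 2 * r <= t <= p + 3 / 2 * r.
    by move: B1; rewrite ltr_norml => /andP[? ?]; apply/andP; split; lra.
  by case: {n2} e2 => /=; lra.
by move: (_ <= _ <= _) => w; case: e1 e2 w {n1 n2} => [] [] [] /=; lra.
Qed.

(** Integrating [indic_overlap] over [t]: the part of [E] in the ball and its reflection each
    contribute more than [9 / 5 * r], the enclosing interval has length [3 * r], and
    [2 * (9 / 5) - 3 = 3 / 5]. *)
Lemma conv_indic_ge (E : set R) (p r : R) : measurable E -> intg (\1_E) -> 0 < r ->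
  ((9 / 5 * r)%:E < mu (E `&` ball p r))%E ->
  forall x, `|x - 2 * p| <= r / 2 -> 3 / 5 * r <= convolution (\1_E) (\1_E) x.
Proof.
move=> mE E1 r0 Er x xp.
have bE := @bdd_mfun_indic R E mE.
pose A := E `&` ball p r.
have mA : measurable A by apply: measurableI => //; exact: measurable_ball.
have bA := bdd_mfun_indic mA.
have A1 : intg (\1_A).
  apply: (le_integrable measurableT _ _ E1).
    by apply/measurable_EFinP; case: bA.
  move=> t _ /=; rewrite lee_fin !indicE /A in_setI.
  by case: (t \in E); case: (t \in _); rewrite /= ?normr0 ?normr1.
have IA : \int[mu]_t \1_A t = fine (mu A).
  by rewrite /Rintegral integral_indic// setIT.
have Ag : 9 / 5 * r < \int[mu]_t \1_A t.
  rewrite IA -lte_fin fineK//.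
  have := integrable_fin_num measurableT A1.
  by rewrite /= integral_indic// setIT.
have [a aE] : exists a, a = p - 3 / 2 * r by exists (p - 3 / 2 * r).
have [b bbE] : exists b, b = p + 3 / 2 * r by exists (p + 3 / 2 * r).
have W1 := @integrable_indic_itv R a b true false.
have IW : \int[mu]_t \1_[set` `[a, b]] t = 3 * r.
  have mW : mu [set` `[a, b]] = (3 * r)%:E.
    rewrite lebesgue_measure_itv/= lte_fin ifT; last by rewrite aE bbE; lra.
    by rewrite -EFinB; congr EFin; rewrite aE bbE; lra.
  by rewrite /Rintegral integral_indic//= setIT mW.
have RA1 : intg (fun t => \1_A (x - t)).
  apply/integrableP; split.
    by apply/measurable_EFinP; case: (bdd_mfun_reflect x bA).
  rewrite (ge0_integral_reflect x (u := fun t => `|(\1_A t)%:E|%E))//.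
    by case/integrableP: A1.
  by apply: measurableT_comp => //; apply/measurable_EFinP; case: bA.
have IR : \int[mu]_t \1_A (x - t) = \int[mu]_t \1_A t.
  congr fine; apply: (ge0_integral_reflect x (u := fun t => (\1_A t)%:E)).
    by apply/measurable_EFinP; case: bA.
  by move=> t; rewrite lee_fin.
have H : \int[mu]_t (-1 * \1_[set` `[a, b]] t + (1 * \1_A (x - t) + \1_A t)) <=
    convolution (\1_E) (\1_E) x.
  rewrite /convolution; apply: le_Rintegral => //.
  - by do 2? apply: integrable_lin => //.
  - exact: conv_bdd_int.
  move=> t _; rewrite !indicE /A !in_setI; move: (t : R) => {}t.
  have ballE (y : R) : (y \in (ball p r : set R)) = (`|p - y| < r).
    by apply/idP/idP; rewrite inE.
  have itvE (y : R) : (y \in [set` `[a, b]]) = (p - 3 / 2 * r <= y <= p + 3 / 2 * r).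
    by apply/idP/idP; rewrite inE /= in_itv/= aE bbE.
  rewrite !ballE itvE; exact: indic_overlap.
refine (le_trans _ H); rewrite Rintegral_lin//; last by apply: integrable_lin.
rewrite Rintegral_lin// IR IW.
by move: (Rintegral _ _ _) Ag => I AI; clear -AI; lra.
Qed.
End density.

(** * Invariance under a positive functional, and the variance argument *)

Section positive_functional.
Context {R : realType}.
Local Notation mu := (@lebesgue_measure R).
Local Notation intg f := (mu.-integrable setT (EFin \o f)).
(** [L] is the mean read on functions instead of classes; it is later instantiated by
    [functional_on_fun m]. *)
Variable L : (R -> R) -> R.
Hypothesis L_lin : forall (a : R) (phi psi : R -> R), bdd_mfun phi ->
  bdd_mfun psi -> L (fun x => a * phi x + psi x) = a * L phi + L psi.
Hypothesis L_ge0 : forall phi : R -> R, bdd_mfun phi ->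
  (forall x, 0 <= phi x) -> 0 <= L phi.

(** Membership in the set [K] of the overview, with integrability of [f] kept as a separate
    hypothesis. *)
Definition conv_inv (f : R -> R) : Prop := forall phi, bdd_mfun phi ->
  L (convolution f phi) = (\int[mu]_t f t) * L phi.

Let L_cst0 : L (fun=> 0) = 0.
Proof.
have := L_lin 1 (bdd_mfun_cst 0) (bdd_mfun_cst 0).
rewrite (_ : (fun=> _) = (fun=> 0)); last by apply/funext => x; ring.
lra.
Qed.

Let LZ (a : R) (phi : R -> R) : bdd_mfun phi -> L (fun x => a * phi x) = a * L phi.
Proof.
move=> bphi; have := L_lin a bphi (bdd_mfun_cst 0); rewrite L_cst0 addr0 => <-.
by congr L; apply/funext => x; rewrite addr0.
Qed.

Lemma conv_inv_lin (a : R) (f g : R -> R) : intg f -> intg g ->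
  conv_inv f -> conv_inv g -> conv_inv (fun t => a * f t + g t).
Proof.
move=> f1 g1 Lf Lg phi bphi.
rewrite convDl// L_lin//; [|exact: bdd_mfun_conv..].
by rewrite Lf// Lg// Rintegral_lin//; ring.
Qed.

(** For the probability density [f], the expectation of [(u - y - l b)^2] is nonnegative. Since [u]
    has mean [y] and [b] has mean 0, the term in [y b] vanishes and the terms in [y] add up to
    [- y * y]. *)
Lemma variance_ge0 (f b u : R -> R) (l y : R) : intg f -> (forall t, 0 <= f t) ->
  \int[mu]_t f t = 1 -> bdd_mfun b -> bdd_mfun u ->
  \int[mu]_t (b t * f t) = 0 -> \int[mu]_t (u t * f t) = y ->
  0 <= \int[mu]_t (u t * u t * f t) - y * y
    + ((- (2 * l)) * \int[mu]_t (u t * (b t * f t))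
       + l ^+ 2 * \int[mu]_t (b t * b t * f t)).
Proof.
move=> f1 f0 If bb bu Ib Iu.
pose E v := \int[mu]_t (v t * f t).
have El a v w : bdd_mfun v -> bdd_mfun w ->
    E (fun t => a * v t + w t) = a * E v + E w.
  move=> bv bw; rewrite /E -Rintegral_lin; [|exact: integrable_bddM..].
  by apply: eq_Rintegral => t _; ring.
have b1 := @bdd_mfun_cst R 1.
have E1 : E (fun=> 1) = 1.
  by rewrite -[RHS]If; apply: eq_Rintegral => t _; rewrite mul1r.
have Q0 : 0 <= E (fun t => (u t - y - l * b t) ^+ 2).
  by apply: Rintegral_ge0 => t _; rewrite mulr_ge0// sqr_ge0.
have -> : \int[mu]_t (u t * (b t * f t)) = E (fun t => u t * b t).
  by apply: eq_Rintegral => t _; rewrite mulrA.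
rewrite -/(E (fun t => u t * u t)) -/(E (fun t => b t * b t)).
have buu := bdd_mfunM bu bu; have bub := bdd_mfunM bu bb; have bbb := bdd_mfunM bb bb.
(* The expansion is nested in the form [a * E v + E w], so that [El] read from right to left folds
   it back into a single expectation. *)
suff EQ : E (fun t => (u t - y - l * b t) ^+ 2) = (- (2 * y)) * E u +
   (y ^+ 2 * E (fun=> 1) + (2 * l * y * E b + ((- (2 * l)) * E (fun t => u t * b t) +
    (l ^+ 2 * E (fun t => b t * b t) + E (fun t => u t * u t))))).
  move: Q0; rewrite EQ E1 (_ : E b = 0)// (_ : E u = y)//.
  by move: (E _) (E _) (E _) => ? ? ?; lra.
rewrite -!El//; do 5? [exact: bdd_mfun_lin | apply: bdd_mfun_lin => //].
by congr E; apply/funext => t; ring.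
Qed.

Lemma conv_inv_iter (f psi : R -> R) n : intg f -> \int[mu]_t f t = 1 ->
  conv_inv f -> bdd_mfun psi ->
  bdd_mfun (iter n (convolution f) psi) /\ L (iter n (convolution f) psi) = L psi.
Proof.
move=> f1 If Lf bpsi; elim: n => [//|n [IH1 IH2]] /=; split.
  exact: bdd_mfun_conv.
by rewrite Lf// If mul1r.
Qed.

Lemma conv_iter_comm (f h psi : R -> R) n : intg f -> intg h -> bdd_mfun psi ->
  convolution h (iter n (convolution f) psi) =
  iter n (convolution f) (convolution h psi).
Proof.
move=> f1 h1 bpsi; elim: n => [//|n IH] /=.
rewrite -IH conv_comm//; elim: n {IH} => [//|n IH] /=; exact: bdd_mfun_conv.
Qed.

(** Each application of the convolution by [f] to [psi] lowers [L] of the square by at least a fixed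
    multiple of [d ^+ 2]. These values stay nonnegative, so [d = 0]. *)
Lemma conv_inv_mean0 (f b : R -> R) : intg f -> (forall t, 0 <= f t) ->
  \int[mu]_t f t = 1 -> conv_inv f -> bdd_mfun b ->
  \int[mu]_t (b t * f t) = 0 -> conv_inv (fun t => b t * f t).
Proof.
move=> f1 f0 If Lf bb Ib psi bpsi; rewrite Ib mul0r.
have h1 := integrable_bddM f1 bb.
set d := L _.
pose u n := iter n (convolution f) psi.
have bu n : bdd_mfun (u n) by case: (conv_inv_iter n f1 If Lf bpsi).
pose C := \int[mu]_t (b t * b t * f t).
have C0 : 0 <= C.
  by apply: Rintegral_ge0 => t _; rewrite mulr_ge0// -expr2 sqr_ge0.
(* Convolution by [b f] commutes with the iterates of convolution by [f], and these preserve [L]. *)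
have dE n : L (convolution (fun t => b t * f t) (u n)) = d.
  rewrite conv_iter_comm//.
  by case: (conv_inv_iter n f1 If Lf (bdd_mfun_conv h1 bpsi)).
pose v n := L (fun x => u n x * u n x).
have v0 n : 0 <= v n.
  apply: L_ge0; first exact: bdd_mfunM.
  by move=> x; rewrite -expr2 sqr_ge0.
have step l n : v n.+1 <= v n + (- (2 * l) * d + l ^+ 2 * C * L (fun=> 1)).
  have bq := bdd_mfunM (bu n) (bu n); have bq' := bdd_mfunM (bu n.+1) (bu n.+1).
  have bF := bdd_mfun_conv f1 bq; have bh := bdd_mfun_conv h1 (bu n).
  have b1 := @bdd_mfun_cst R 1.
  have : 0 <= L (fun x => -1 * (u n.+1 x * u n.+1 x) +
     (- (2 * l) * convolution (fun t => b t * f t) (u n) x +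
     (l ^+ 2 * C * 1 + convolution f (fun x => u n x * u n x) x))).
    apply: L_ge0 => [|x]; first by do 3 apply: bdd_mfun_lin => //.
    (* The mean of [t -> u n (x - t)] under [f] is by definition the next iterate [u n.+1] at
       [x]. *)
    have := @variance_ge0 f b (fun t => u n (x - t)) l (u n.+1 x) f1 f0 If bb
       (bdd_mfun_reflect x (bu n)) Ib erefl.
    rewrite -/C => /le_trans; apply; rewrite /convolution.
    by move: (Rintegral _ _ _) (Rintegral _ _ _) => ? ?; lra.
  rewrite !L_lin//; do 3? [apply: bdd_mfun_lin => //].
  rewrite -/(v n.+1) dE Lf// If mul1r -/(v n); lra.
have tel l n : v n <= v 0%N + n%:R * (- (2 * l) * d + l ^+ 2 * C * L (fun=> 1)).
  move: (_ + _ * L _) (step l) => X stepX.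
  elim: n => [|n IH]; first by rewrite mul0r addr0.
  by rewrite (le_trans (stepX n))// -natr1 mulrDl mul1r addrA lerD2r.
(* The [+ 1] keeps [K] positive even when [C * L 1] is 0. *)
pose K := C * L (fun=> 1) + 1.
have K1 : 1 <= K.
  by rewrite lerDr mulr_ge0// L_ge0//; exact: bdd_mfun_cst.
(* The choice [l = d / K] nearly minimizes the quadratic in [l]; the decrement per step is then
   [d ^+ 2 / K + (d / K) ^+ 2]. *)
have bnd n : n%:R * (d ^+ 2 / K) <= v 0%N.
  have := le_trans (v0 n) (tel (d / K) n).
  have -> : - (2 * (d / K)) * d + (d / K) ^+ 2 * C * L (fun=> 1)
     = - (d ^+ 2 / K) - (d / K) ^+ 2.
    have K0 : K != 0 by rewrite gt_eqF// (lt_le_trans _ K1).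
    rewrite -[in X in X = _]mulrA (_ : C * L _ = K - 1); last by rewrite /K addrK.
    by field.
  move=> H; have := mulr_ge0 (ler0n R n) (sqr_ge0 (d / K)); nra.
apply/eqP; rewrite -sqrf_eq0; apply/negPn/negP => d0.
have dK : 0 < d ^+ 2 / K.
  by rewrite divr_gt0 ?(lt_le_trans _ K1)// lt_neqAle eq_sym d0 sqr_ge0.
have := bnd (Num.bound (v 0%N / (d ^+ 2 / K))).
apply/negP; rewrite -ltNge -ltr_pdivrMr//.
by rewrite archi_boundP// divr_ge0// ltW.
Qed.

(** With [a] the integral of [b f], the function [b - a] has mean 0 under [f], and
    [b f = a f + (b - a) f]. *)
Lemma conv_inv_hereditary (f b : R -> R) : intg f -> (forall t, 0 <= f t) ->
  \int[mu]_t f t = 1 -> conv_inv f -> bdd_mfun b ->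
  conv_inv (fun t => b t * f t).
Proof.
move=> f1 f0 If Lf bb.
pose a := \int[mu]_t (b t * f t).
pose b' t := 1 * b t + (- a).
have bb' : bdd_mfun b' by apply: bdd_mfun_lin => //; exact: bdd_mfun_cst.
have bf1 := integrable_bddM f1 bb.
have E : (fun t => b' t * f t) = (fun t => - a * f t + b t * f t).
  by apply/funext => t; rewrite /b'; ring.
have Ib' : \int[mu]_t (b' t * f t) = 0.
  by rewrite E Rintegral_lin// If -/a; ring.
have Lb' := conv_inv_mean0 f1 f0 If Lf bb' Ib'.
have -> : (fun t => b t * f t) = (fun t => a * f t + b' t * f t).
  by apply/funext => t; rewrite /b'; ring.
apply: conv_inv_lin => //; exact: integrable_bddM.
Qed.

Lemma conv_inv_conv (f h : R -> R) : intg f -> intg h -> bdd_mfun h ->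
  conv_inv f -> conv_inv h -> conv_inv (convolution f h).
Proof.
move=> f1 h1 bh Lf Lh phi bphi.
rewrite conv_assoc// Lf//; last exact: bdd_mfun_conv.
by rewrite Lh// Rintegral_conv//; ring.
Qed.

(** A further convolution by [k] leaves [L] unchanged, so [L] of [g * phi] equals [L] of
    [k * g * phi], which is [L] of [(g * k) * phi] by commutativity and associativity. *)
Lemma conv_inv_deconv (g k : R -> R) : intg g -> intg k -> bdd_mfun k ->
  \int[mu]_t k t = 1 -> conv_inv k -> conv_inv (convolution g k) -> conv_inv g.
Proof.
move=> g1 k1 bk Ik Lk Lgk phi bphi.
have := Lgk _ bphi; rewrite conv_assoc// conv_comm// Lk; last exact: bdd_mfun_conv.
by rewrite Rintegral_conv// Ik mul1r mulr1.
Qed.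

(** Where [g] is nonzero [f] is at least [c], so [g] is [f] times the bounded function
    [g / max(f, c)]. *)
Lemma conv_inv_dominated (f g : R -> R) (c : R) : intg f ->
  (forall t, 0 <= f t) -> \int[mu]_t f t = 1 -> conv_inv f -> bdd_mfun g ->
  0 < c -> (forall t, g t != 0 -> c <= f t) -> intg g /\ conv_inv g.
Proof.
move=> f1 f0 If Lf bg c0 gf.
pose b t := g t * (Num.max (f t) c)^-1.
have bb : bdd_mfun b.
  by apply: bdd_mfunM => //; apply: bdd_mfun_inv_max => //; exact: intg_meas.
have -> : g = (fun t => b t * f t).
  apply/funext => t; rewrite /b; have [->|gt0] := eqVneq (g t) 0.
    by rewrite !mul0r.
  have cf := gf _ gt0; rewrite (max_l cf) mulfVK// gt_eqF//.
  exact: lt_le_trans cf.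
by split; [exact: integrable_bddM|exact: conv_inv_hereditary].
Qed.

Lemma conv_invZ (a : R) (f : R -> R) : intg f -> conv_inv f ->
  conv_inv (fun t => a * f t).
Proof.
move=> f1 Lf; have := conv_inv_lin (a - 1) f1 f1 Lf Lf.
by congr conv_inv; apply/funext => t; ring.
Qed.

(** * Invariance on one interval, then on all bounded intervals *)

Definition itv_inv (a b : R) : Prop := forall g, bdd_mfun g ->
  (forall t, ~~ (a <= t <= b) -> g t = 0) -> conv_inv g.

Lemma itv_inv_le (a b c d : R) : a <= c -> d <= b -> itv_inv a b -> itv_inv c d.
Proof.
move=> ac db ab g bg g0; apply: ab => // t tab; apply: g0.
apply: contra tab => /andP[ct td].
by rewrite (le_trans ac ct) (le_trans td db).
Qed.

Lemma bdd_supp_integrable (a b : R) (g : R -> R) : bdd_mfun g ->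
  (forall t, ~~ (a <= t <= b) -> g t = 0) -> intg g.
Proof.
move=> bg g0; have i1 := @integrable_indic_itv R a b true false.
suff -> : g = (fun t => g t * \1_[set` `[a, b]] t) by exact: integrable_bddM.
apply/funext => t; rewrite indicE; have [abt|abt] := boolP (a <= t <= b).
  by rewrite mem_set ?mulr1//= in_itv.
by rewrite g0 ?mul0r.
Qed.

Lemma itv_inv_exists (f : R -> R) : intg f -> (forall t, 0 <= f t) ->
  \int[mu]_t f t = 1 -> conv_inv f -> exists a b, a < b /\ itv_inv a b.
Proof.
move=> f1 f0 If Lf.
have [|c [E [c0 mE E0 Ef]]] := pos_level_set f1; first by rewrite If.
have bE := @bdd_mfun_indic R E mE.
have [|E1 LE] := conv_inv_dominated f1 f0 If Lf bE c0.
  by move=> t; rewrite indicE; case: (boolP (t \in E)) => [/set_mem/Ef //|]; rewrite eqxx.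
have [p [r [r0 Er]]] := density_ball mE E0.
pose al := \int[mu]_t (\1_E t : R).
have al0 : 0 < al.
  have := integrable_fin_num measurableT E1.
  rewrite /al /Rintegral /= integral_indic// setIT => fE.
  by rewrite -lte_fin fineK.
have Lk0 := conv_inv_conv E1 E1 bE LE LE.
have k01 := integrable_conv E1 E1 bE.
have Ik0 := Rintegral_conv E1 E1 bE.
(* The self-convolution of [\1_E] has integral [al * al]; after normalization [k] is a nonnegative
   density of integral 1 and can take the place of [f] in [conv_inv_dominated]. *)
pose k t := (al * al)^-1 * convolution (\1_E) (\1_E) t.
have al2 : 0 < al * al by rewrite mulr_gt0.
have k1 : intg k.
  exact: (@integrableZl _ _ _ mu setT measurableT _ _ k01).
have k0 t : 0 <= k t.
  rewrite /k mulr_ge0 ?invr_ge0 ?(ltW al2)//; apply: Rintegral_ge0 => s _.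
  by rewrite mulr_ge0.
have Ik : \int[mu]_t k t = 1.
  by rewrite /k RintegralZl// Ik0 mulVf// gt_eqF.
have Lk : conv_inv k by exact: conv_invZ.
exists (2 * p - r / 2), (2 * p + r / 2); split; first by lra.
move=> g bg g0.
have c1 : 0 < (al * al)^-1 * (3 / 5 * r) by rewrite mulr_gt0 ?invr_gt0// mulr_gt0.
apply: (conv_inv_dominated k1 k0 Ik Lk bg c1 _).2 => t gt0.
rewrite /k ler_wpM2l ?invr_ge0 ?(ltW al2)//; apply: (conv_indic_ge mE E1 r0 Er).
have : 2 * p - r / 2 <= t <= 2 * p + r / 2.
  by apply: contraNT gt0 => /g0 ->.
by rewrite ler_norml => /andP[? ?]; apply/andP; split; lra.
Qed.

(** Let [k] be the normalized indicator of [[c, d]]. For [g] supported in [[x, y]], the convolution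
    of [g] and [k] is supported in [[x + c, y + d]]. Both this interval and [[c, d]] lie in
    [[a, b]], so [g] is recovered by [conv_inv_deconv]. *)
Lemma itv_inv_spread (a b c d x y : R) : c < d -> a <= c -> d <= b ->
  a <= x + c -> y + d <= b -> itv_inv a b -> itv_inv x y.
Proof.
move=> cd ac db axc ydb ab g bg g0.
have g1 := bdd_supp_integrable bg g0.
have i1 := @integrable_indic_itv R c d true false.
have b1 : bdd_mfun (\1_[set` `[c, d]] : R -> R) by exact: bdd_mfun_indic.
pose k t := (d - c)^-1 * \1_[set` `[c, d]] t.
have k1 : intg k by exact: (@integrableZl _ _ _ mu setT measurableT _ _ i1).
have bk : bdd_mfun k by apply: bdd_mfunM => //; exact: bdd_mfun_cst.
have k0 t : ~~ (c <= t <= d) -> k t = 0.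
  by move=> ct; rewrite /k indicE memNset ?mulr0//= in_itv/=; exact/negP.
have dc : 0 < d - c by rewrite subr_gt0.
have Ik : \int[mu]_t k t = 1.
  have mW : mu [set` `[c, d]] = (d - c)%:E.
    by rewrite lebesgue_measure_itv/= lte_fin cd.
  rewrite /k RintegralZl// /Rintegral integral_indic//= setIT mW /=.
  by rewrite mulVf// gt_eqF.
apply: (conv_inv_deconv g1 k1 bk Ik).
  apply: ab => // t abt; apply: k0; apply: contra abt => /andP[ct td].
  by rewrite (le_trans ac ct) (le_trans td db).
apply: ab; first exact: bdd_mfun_conv.
move=> z abz; rewrite /convolution (_ : Rintegral _ _ _ = \int[mu]_t 0).
  by rewrite Rintegral_cst// mul0r.
apply: eq_Rintegral => t _.
have [xt|/g0 ->] := boolP (x <= t <= y); last by rewrite mulr0.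
have [ct|/k0 ->] := boolP (c <= z - t <= d); last by rewrite mul0r.
by move: abz xt ct => /negP abz /andP[? ?] /andP[? ?]; case: abz; apply/andP; split; lra.
Qed.

(** A function is cut at [b] into a part living on the left and a part living on the right. *)
Lemma itv_inv_cat (a b c : R) : itv_inv a b -> itv_inv b c -> itv_inv a c.
Proof.
move=> ab bc g bg g0.
pose A := [set` `]-oo, b]] : set R.
have mA : measurable A by exact: measurable_itv.
pose g1 t := \1_A t * g t; pose g2 t := -1 * g1 t + g t.
have bg1 : bdd_mfun g1 by apply: bdd_mfunM => //; exact: bdd_mfun_indic.
have bg2 : bdd_mfun g2 by exact: bdd_mfun_lin.
have tA t : (t \in A) = (t <= b).
  by apply/idP/idP; rewrite inE /A /= in_itv.
have s1 t : ~~ (a <= t <= b) -> g1 t = 0.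
  rewrite /g1 indicE tA; have [tb|] := leP t b; last by rewrite mul0r.
  rewrite andbT => /negP at_; rewrite g0 ?mulr0//.
  by apply/negP => /andP[at' _]; apply: at_.
have s2 t : ~~ (b <= t <= c) -> g2 t = 0.
  rewrite /g2 /g1 indicE tA; have [tb _|bt /negP bc'] := leP t b; first by rewrite mul1r mulN1r addNr.
  rewrite g0 ?mulr0 ?addr0//; apply/negP => /andP[_ tc]; apply: bc'.
  by rewrite (ltW bt).
have := conv_inv_lin 1 (bdd_supp_integrable bg1 s1) (bdd_supp_integrable bg2 s2)
  (ab _ bg1 s1) (bc _ bg2 s2).
by congr conv_inv; apply/funext => t; rewrite /g2; ring.
Qed.

Lemma itv_inv_total (a b : R) : a < b -> itv_inv a b -> forall x y, itv_inv x y.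
Proof.
move=> ab Iab.
pose d := (b - a) / 4; have d0 : 0 < d by rewrite /d; lra.
(* Recentring at 0: adding the middle half [[a + d, b - d]] to [[- d, d]] gives exactly [[a, b]]. *)
have I0 : itv_inv (- d) d.
  have dE : b = a + 4 * d by rewrite /d; field.
  by apply: (itv_inv_spread (c := a + d) (d := b - d) _ _ _ _ _ Iab); lra.
clearbody d.
(* The radius grows by [d / 2] at each step: shifts between [d / 2] and [d] towards the centre bring
   the two new end pieces back inside [[- r, r]], and the three intervals are then joined. *)
have In n : itv_inv (- (d + n%:R * (d / 2))) (d + n%:R * (d / 2)).
  elim: n => [|n IH]; first by rewrite mul0r addr0.
  rewrite -natr1; have := mulr_ge0 (ler0n R n) (ltW d0).
  move: (n%:R) IH => m IH md.
  pose r := d + m * (d / 2).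
  have rE : d + (m + 1) * (d / 2) = r + d / 2 by rewrite /r; ring.
  have dr : d <= r by rewrite /r; lra.
  rewrite rE; rewrite -/r in IH; clearbody r.
  have Ir : itv_inv r (r + d / 2).
    by apply: (itv_inv_spread (c := - d) (d := - (d / 2)) _ _ _ _ _ IH); lra.
  have Il : itv_inv (- (r + d / 2)) (- r).
    by apply: (itv_inv_spread (c := d / 2) (d := d) _ _ _ _ _ IH); lra.
  exact: (itv_inv_cat (itv_inv_cat Il IH) Ir).
move=> x y.
pose n := Num.bound ((`|x| + `|y|) / (d / 2)).
have dn : `|x| + `|y| < n%:R * (d / 2).
  rewrite -ltr_pdivrMr; last by lra.
  by rewrite archi_boundP// divr_ge0 ?addr_ge0//; lra.
apply: itv_inv_le (In n).
- have := ler_norm (- x); rewrite normrN; have := normr_ge0 y; lra.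
- have := ler_norm y; have := normr_ge0 x; lra.
Qed.

(** * Passage to the limit in the integral norm *)

Lemma L_le_norm (phi : R -> R) (M : R) : bdd_mfun phi ->
  (forall x, `|phi x| <= M) -> `|L phi| <= M * L (fun=> 1).
Proof.
move=> bphi phiM; have bM := @bdd_mfun_cst R M.
have LM : L (fun=> M) = M * L (fun=> 1).
  rewrite -LZ; last exact: bdd_mfun_cst.
  by congr L; apply/funext => x; rewrite mulr1.
rewrite ler_norml -LM; apply/andP; split.
  suff : 0 <= L (fun x => 1 * phi x + M) by rewrite L_lin//; lra.
  apply: L_ge0 => [|x]; first exact: bdd_mfun_lin.
  by have := phiM x; rewrite ler_norml => /andP[? ?]; lra.
suff : 0 <= L (fun x => -1 * phi x + M) by rewrite L_lin//; lra.
apply: L_ge0 => [|x]; first exact: bdd_mfun_lin.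
by have := phiM x; rewrite ler_norml => /andP[? ?]; lra.
Qed.

(** As [h] satisfies the identity, the defect of [g] equals that of [g - h], which is at most the
    norm of [g - h] times [M * L 1 + |L phi|]. *)
Lemma conv_inv_closed (g : R -> R) : intg g ->
  (forall e, 0 < e -> exists h, [/\ intg h, conv_inv h &
    \int[mu]_t `|-1 * h t + g t| <= e]) -> conv_inv g.
Proof.
move=> g1 gh phi bphi; have [mphi [M phiM]] := bphi.
have M0 : 0 <= M by rewrite (le_trans _ (phiM 0)).
have L1 : 0 <= L (fun=> 1) by apply: L_ge0 => //; exact: bdd_mfun_cst.
apply/eqP; rewrite -subr_eq0 -normr_le0; apply/ler_addgt0Pl => e e0.
(* The [+ 1] makes [C] positive, so that [e / C] is an admissible tolerance. *)
pose C := M * L (fun=> 1) + `|L phi| + 1.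
have C0 : 0 < C by rewrite /C ltr_wpDl// addr_ge0// mulr_ge0.
have [h [h1 Lh he]] := gh _ (divr_gt0 e0 C0).
have r1 := integrable_lin (-1) h1 g1.
pose rn t := -1 * h t + g t.
have E : L (convolution g phi) - (\int[mu]_t g t) * L phi =
    L (convolution rn phi) - (\int[mu]_t rn t) * L phi.
  rewrite /rn convDl// L_lin; [|exact: bdd_mfun_conv..].
  by rewrite Lh// Rintegral_lin//; ring.
rewrite E addr0.
have I0 : 0 <= \int[mu]_t `|rn t| by exact: Rintegral_ge0.
have B1 : `|L (convolution rn phi)| <= M * \int[mu]_t `|rn t| * L (fun=> 1).
  apply: L_le_norm; first exact: bdd_mfun_conv.
  by move=> x; exact: conv_norm_le.
have B2 : `|(\int[mu]_t rn t) * L phi| <= \int[mu]_t `|rn t| * `|L phi|.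
  by rewrite normrM ler_wpM2r//; exact: le_normr_Rintegral.
rewrite (le_trans (ler_normB _ _))// (le_trans (lerD B1 B2))//.
have : (\int[mu]_t `|rn t|) * C <= e by rewrite -ler_pdivlMr.
apply: le_trans; rewrite /C; move: I0 L1; move: (Rintegral _ _ _) => I I0 L1; nra.
Qed.

(** Dominated convergence, with dominating function [|g|], for [g] cut to the points where both
    [|t|] and [|g t|] are at most [n]. *)
Lemma L1_truncation (g : R -> R) : intg g -> forall e, 0 < e ->
  exists h, exists N, [/\ bdd_mfun h, (forall t, ~~ (- N <= t <= N) -> h t = 0) &
    \int[mu]_t `|-1 * h t + g t| <= e].
Proof.
move=> g1 e e0; have mg := intg_meas g1.
pose c n t : bool := (`|t| <= n%:R) && (`|g t| <= n%:R).
pose h n t : R := if c n t then g t else 0.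
have mc n : measurable_fun setT (c n).
  by apply: measurable_and; apply: measurable_fun_ler => //; exact: measurableT_comp.
have mh n : measurable_fun setT (h n).
  by apply: measurable_fun_ifT => //; exact: mc.
have hg n t : `|h n t| <= `|g t| by rewrite /h; case: ifP; rewrite ?normr0.
have bh n : bdd_mfun (h n).
  split=> //; exists n%:R => t; rewrite /h.
  by case: ifPn => [/andP[]//|_]; rewrite normr0.
have cvh t : (h n t)%:E @[n --> \oo] --> (g t)%:E.
  apply: cvg_near_cst; near=> n.
  rewrite /h /c ifT//; apply/andP; split; near: n; exact: nbhs_infty_ger.
have mEh n : measurable_fun setT (EFin \o h n) by exact/measurable_EFinP.
have mEg : measurable_fun setT (EFin \o g) by exact/measurable_EFinP.
have ae1 : \forall t \ae mu, setT t ->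
    (EFin \o h n) t @[n --> \oo] --> (EFin \o g) t.
  by apply: aeW => t _; exact: cvh.
have ae2 : \forall t \ae mu, forall n, setT t ->
    (`|(EFin \o h n) t| <= (abse \o (EFin \o g)) t)%E.
  by apply: aeW => t n _; rewrite /= lee_fin.
have [_ Hc _] := @dominated_convergence _ (measurableTypeR R) R mu setT
  measurableT (fun n => EFin \o h n) (EFin \o g) (abse \o (EFin \o g))
  mEh mEg ae1 (integrable_abse g1) ae2.
have /fine_cvgP[_ /= cv] := Hc.
have [n Hn] : exists n, fine (\int[mu]_x `|(h n x)%:E - (g x)%:E|)%E < e.
  by have [n hn] := filter_ex (cvgr_lt _ cv _ e0); exists n.
exists (h n), n%:R; split=> //.
  move=> t nt; rewrite /h /c ifF//; apply/negbTE; apply: contra nt.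
  by rewrite ler_norml => /andP[].
apply: le_trans (ltW Hn); rewrite le_eqVlt; apply/orP; left; apply/eqP.
by congr fine; apply: eq_integral => t _; rewrite -EFinB abse_EFin distrC mulN1r addrC.
Unshelve. all: by end_near. Qed.

Lemma conv_inv_total (f : R -> R) : intg f -> (forall t, 0 <= f t) ->
  \int[mu]_t f t = 1 -> conv_inv f -> forall g, intg g -> conv_inv g.
Proof.
move=> f1 f0 If Lf g g1.
have [a [b [ab Iab]]] := itv_inv_exists f1 f0 If Lf.
apply: conv_inv_closed => // e e0.
have [h [N [bh h0 he]]] := L1_truncation g1 e0.
exists h; split=> //; first exact: bdd_supp_integrable bh h0.
exact: (itv_inv_total ab Iab bh h0).
Qed.

End positive_functional.

(** * From functions back to classes and means *)

Section transfer.
Context {R : realType}.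
Local Notation mu := (@lebesgue_measure R).
Local Notation intg f := (mu.-integrable setT (EFin \o f)).

Lemma bdd_mfun_Lfun (phi : R -> R) : bdd_mfun phi -> phi \in Lfun mu +oo%E.
Proof.
move=> [mphi [M phiM]]; rewrite inE; apply/andP; split; rewrite inE//.
rewrite /= /finite_norm unlock /Lnorm; case: ifP => // _.
apply: (@le_lt_trans _ _ M%:E); last exact: ltry.
by apply/ess_supP/nearW => x /=; rewrite lee_fin.
Qed.

Lemma Lspace_measurable (p : \bar R) (p1 : (1 <= p)%E) (phi : LspaceType mu p1) :
  measurable_fun setT (Lspace_fun phi).
Proof. exact: (@measurable_funPT _ _ _ _ (Lspace_repr phi)). Qed.

(** The representative is set to 0 where it exceeds its essential bound, which happens on a null
    set. *)
Lemma Linfty_bdd_version (phi : Linfty R) :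
  exists2 psi : R -> R, bdd_mfun psi & Lspace_fun phi = psi %[ae mu].
Proof.
have [M M0 phiM] := Linfty_ae_bound (Lspace_repr phi).
have mphi := Lspace_measurable phi.
pose c (t : R) : bool := `|Lspace_fun phi t| <= M.
exists (fun t => if c t then Lspace_fun phi t else 0).
  split; last by exists M => t; rewrite /c; case: ifP; rewrite ?normr0.
  apply: measurable_fun_ifT => //.
  by apply: measurable_fun_ler => //; exact: measurableT_comp.
by near=> t => _; rewrite /c ifT//; near: t; exact: phiM.
Unshelve. all: by end_near. Qed.

(** A class can only be formed from a proof of membership in [Lfun], hence the case distinction; the
    value 0 elsewhere is a default that bounded measurable functions never meet. *)
Definition functional_on_fun (m : {scalar Linfty R}) (phi : R -> R) : R :=
  match pselect (phi \in Lfun mu +oo%E) with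
  | left H => m (Lspace_class (Lfun_Sub (leey 1%E) H))
  | right _ => 0
  end.

Lemma functional_on_funE (m : {scalar Linfty R}) (phi : R -> R) (psi : Linfty R) :
  bdd_mfun phi -> Lspace_fun psi = phi %[ae mu] ->
  functional_on_fun m phi = m psi.
Proof.
move=> bphi psiphi; rewrite /functional_on_fun.
case: pselect => [H|/(_ (bdd_mfun_Lfun bphi))//]; congr (m _).
apply: Lspace_eq; have HC := Lspace_classE (Lfun_Sub (leey 1%E) H).
by near=> x => _; rewrite (near HC x)// (near psiphi x).
Unshelve. all: by end_near. Qed.

Lemma bdd_class (phi : R -> R) : bdd_mfun phi ->
  exists Phi : Linfty R, Lspace_fun Phi = phi %[ae mu].
Proof.
move=> bphi; exists (Lspace_class (Lfun_Sub (leey 1%E) (bdd_mfun_Lfun bphi))).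
exact: Lspace_classE.
Qed.

Lemma functional_on_fun_lin (m : {scalar Linfty R}) (a : R) (phi psi : R -> R) :
  bdd_mfun phi -> bdd_mfun psi ->
  functional_on_fun m (fun x => a * phi x + psi x) =
  a * functional_on_fun m phi + functional_on_fun m psi.
Proof.
move=> bphi bpsi; have [Phi HPhi] := bdd_class bphi; have [Psi HPsi] := bdd_class bpsi.
rewrite (functional_on_funE m bphi HPhi) (functional_on_funE m bpsi HPsi).
rewrite (@functional_on_funE m _ (a *: Phi + Psi)) ?linearP//; first exact: bdd_mfun_lin.
have H1 := Lspace_addE (a *: Phi) Psi; have H2 := Lspace_scaleE a Phi.
near=> x => _; rewrite (near H1 x)//= (near H2 x)//=.
by rewrite (near HPhi x)// (near HPsi x).
Unshelve. all: by end_near. Qed.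

Lemma functional_on_fun_ge0 (m : {scalar Linfty R}) (phi : R -> R) : is_mean m ->
  bdd_mfun phi -> (forall x, 0 <= phi x) -> 0 <= functional_on_fun m phi.
Proof.
move=> [_ m0 _] bphi phi0; have [Phi HPhi] := bdd_class bphi.
rewrite (functional_on_funE m bphi HPhi); apply: m0.
by near=> x; rewrite (near HPhi x).
Unshelve. all: by end_near. Qed.

Lemma ae_eq_convl (f g phi : R -> R) : measurable_fun setT f ->
  measurable_fun setT g -> measurable_fun setT phi -> f = g %[ae mu] ->
  convolution f phi = convolution g phi.
Proof.
move=> mf mg mphi fg; apply/funext => x; congr fine.
have mr : measurable_fun setT (fun t : R => phi (x - t)).
  by apply: (measurableT_comp mphi); exact: measurable_funB.
apply: ae_eq_integral => //; try by apply/measurable_EFinP; exact: measurable_funM.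
by near=> t => _; rewrite (near fg t).
Unshelve. all: by end_near. Qed.

(** The positive part of a representative is nonnegative everywhere, as the variance argument
    requires, and agrees with it almost everywhere. *)
Lemma L1flat_version (f : L1 R) : L1flat f -> exists g : R -> R,
  [/\ intg g, forall t, 0 <= g t, \int[mu]_t g t = 1 & Lspace_fun f = g %[ae mu]].
Proof.
move=> [f0 ff]; have mf := Lspace_measurable f.
have f1 : intg (Lspace_fun f) by exact: (L1_integrable (Lspace_repr f)).
pose g t := Num.max (Lspace_fun f t) 0.
have mg : measurable_fun setT g by exact: measurable_maxr.
have fg : Lspace_fun f = g %[ae mu].
  by near=> t => _; rewrite /g max_l//; near: t.
have g1 : intg g.
  apply: (le_integrable measurableT _ _ f1); first exact/measurable_EFinP.
  move=> t _ /=; rewrite lee_fin /g.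
  by have [h|h] := leP (Lspace_fun f t) 0; rewrite ?normr0.
exists g; split => //; first by move=> t; rewrite /g le_max lexx orbT.
have <- : \int[mu]_t Lspace_fun f t = \int[mu]_t g t.
  congr fine; apply: ae_eq_integral => //; try exact/measurable_EFinP.
  by near=> t => _; rewrite (near fg t).
(* The integral is the real part of the Fourier transform at 0, where the cosine factor is 1. *)
apply: etrans (congr1 (@complex.Re R) ff).
by apply: eq_Rintegral => t _; rewrite mul0r cos0 mulr1.
Unshelve. all: by end_near. Qed.

(** Convolution is insensitive to the representatives of both factors, so [conv_op] may be computed
    on the chosen versions. *)
Lemma functional_on_fun_conv (m : {scalar Linfty R}) (f : L1 R) (g phi : R -> R)
    (Phi : Linfty R) : intg g -> Lspace_fun f = g %[ae mu] -> bdd_mfun phi ->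
  Lspace_fun Phi = phi %[ae mu] ->
  functional_on_fun m (convolution g phi) = m (conv_op f Phi).
Proof.
move=> g1 fg bphi HPhi; apply: functional_on_funE; first exact: bdd_mfun_conv.
have HC : Lspace_fun (conv_op f Phi) =
  convolution (Lspace_fun f) (Lspace_fun Phi) %[ae mu] by exact: Lspace_classE.
have mf := Lspace_measurable f; have mPhi := Lspace_measurable Phi.
have mg := intg_meas g1; have [mphi _] := bphi.
near=> x => _; rewrite (near HC x)// (ae_eq_conv x mf mPhi mphi HPhi).
by rewrite (ae_eq_convl mf mg mphi fg).
Unshelve. all: by end_near. Qed.

(** Invariance under [f] becomes [conv_inv] for its nonnegative version, [conv_inv_total] extends it
    to a version of [g], and the integral 1 of the latter gives invariance under [g]. *)
Lemma invariant_mean_conv_op (m : {scalar Linfty R}) (f : L1 R) : L1flat f ->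
  is_mean m -> (forall phi : Linfty R, m (conv_op f phi) = m phi) ->
  forall g : L1 R, L1flat g -> forall phi : Linfty R, m (conv_op g phi) = m phi.
Proof.
move=> /L1flat_version[f' [f1 f0 If ff']] mm mf g /L1flat_version[g' [g1 _ Ig gg']] Phi.
have [phi bphi HPhi] := Linfty_bdd_version Phi.
rewrite -(functional_on_fun_conv m g1 gg' bphi HPhi).
rewrite -(functional_on_funE m bphi HPhi).
have Lf : conv_inv (functional_on_fun m) f'.
  move=> psi bpsi; have [Psi HPsi] := bdd_class bpsi.
  by rewrite (functional_on_fun_conv m f1 ff' bpsi HPsi) mf If mul1r
    (functional_on_funE m bpsi HPsi).
rewrite (conv_inv_total (@functional_on_fun_lin m)
  (fun psi => @functional_on_fun_ge0 m psi mm) f1 f0 If Lf g1 bphi).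
by rewrite Ig mul1r.
Qed.

End transfer.

Unset Implicit Arguments.

Theorem corollary3p3 (R : realType) (f : L1 R) (hf : L1flat f) :
  invariant_means (conv_op f) = top_invariant_means R /\
  (forall m : {scalar Linfty R}, is_mean m ->
     ((forall g : L1 R, L1flat g ->
         forall phi : Linfty R, m (conv_op g phi) = m phi) <->
      (forall phi : Linfty R, m (conv_op f phi) = m phi))).
Proof.
split.
  apply/seteqP; split=> m /= [mm inv]; split=> //; last exact: inv.
  exact: invariant_mean_conv_op hf mm inv.
move=> m mm; split=> [inv|inv]; first exact: inv.
exact: invariant_mean_conv_op hf mm inv.
Qed.
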